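(* The forgetful functor from the category $\mathsf{BLR}$ of bi-Legendrian racks to the category $\mathsf{GLR}$ of GL-racks, sending $(R,\mathtt{u},\mathtt{d})$ to $(R,\mathtt{u})$ and each morphism to itself, is an isomorphism of categories. Hence, the data and axioms of GL-racks are equivalent to those of bi-Legendrian racks.
   Context: A rack is a pair $(X,s)$ of a set $X$ and a map $s:X\to S_X$, $x\mapsto s_x$ ($S_X$ the group of permutations of $X$), such that $s_xs_y=s_{s_x(y)}s_x$ for all $x,y\in X$; products of maps denote composition. A rack homomorphism $(X,s)\to(Y,t)$ is a map $\varphi:X\to Y$ with $\varphi s_x=t_{\varphi(x)}\varphi$ for all $x$. A GL-structure on $R=(X,s)$ is a rack automorphism $\mathtt{u}$ of $R$ with $\mathtt{u}s_x=s_x\mathtt{u}$ for all $x\in X$; $(R,\mathtt{u})$ is then a GL-rack. A GL-rack homomorphism $(R_1,\mathtt{u}_1)\to(R_2,\mathtt{u}_2)$ is a rack homomorphism $\varphi$ with $\varphi\mathtt{u}_1=\mathtt{u}_2\varphi$. A bi-Legendrian structure on $R=(X,s)$ is a pair $(\mathtt{u},\mathtt{d})$ of maps $\mathtt{u},\mathtt{d}:X\to X$ such that for all $x\in X$: (L1) $\mathtt{u}\mathtt{d}s_x(x)=x=\mathtt{d}\mathtt{u}s_x(x)$; (L2) $\mathtt{u}s_x=s_x\mathtt{u}$ and $\mathtt{d}s_x=s_x\mathtt{d}$; (L3) $s_{\mathtt{u}(x)}=s_x=s_{\mathtt{d}(x)}$. The triple $(R,\mathtt{u},\mathtt{d})$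 is then a bi-Legendrian rack. A bi-Legendrian rack homomorphism $(R_1,\mathtt{u}_1,\mathtt{d}_1)\to(R_2,\mathtt{u}_2,\mathtt{d}_2)$ is a rack homomorphism $\varphi:R_1\to R_2$ with $\varphi\mathtt{u}_1=\mathtt{u}_2\varphi$ and $\varphi\mathtt{d}_1=\mathtt{d}_2\varphi$. (If $(R,\mathtt{u},\mathtt{d})$ is a bi-Legendrian rack, then $(R,\mathtt{u})$ is a GL-rack, so the forgetful functor is well defined.) *)

(* Defs.v *)
From mathcomp Require Import all_boot.
From mathcomp Require Import boolp.

Set Implicit Arguments.
Unset Strict Implicit.
Unset Printing Implicit Defensive.

(* Categories, with laws stated for Leibniz equality of morphisms. *)

Record category := Category {
  obj :> Type;
  hom : obj -> obj -> Type;
  idm : forall a, hom a a;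
  comp : forall a b c, hom b c -> hom a b -> hom a c;
  comp_idl : forall a b (f : hom a b), comp (idm b) f = f;
  comp_idr : forall a b (f : hom a b), comp f (idm a) = f;
  comp_assoc : forall a b c d (h : hom c d) (g : hom b c) (f : hom a b),
    comp h (comp g f) = comp (comp h g) f
}.

Record functor (C D : category) := Functor {
  fobj :> C -> D;
  fmap : forall a b : C, hom a b -> hom (fobj a) (fobj b);
  fmap_id : forall a : C, fmap (idm a) = idm (fobj a);
  fmap_comp : forall (a b c : C) (g : hom b c) (f : hom a b),
    fmap (comp g f) = comp (fmap g) (fmap f)
}.

Definition functor_id (C : category) : functor C C :=
  @Functor C C (fun a => a) (fun a b f => f)
    (fun a => erefl) (fun a b c g f => erefl).

Lemma functor_comp_id (C D E : category) (G : functor D E) (F : functor C D)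
  (a : C) : fmap G (fmap F (idm a)) = idm (G (F a)).
Proof. by rewrite !fmap_id. Qed.

Lemma functor_comp_comp (C D E : category) (G : functor D E) (F : functor C D)
  (a b c : C) (g : hom b c) (f : hom a b) :
  fmap G (fmap F (comp g f)) = comp (fmap G (fmap F g)) (fmap G (fmap F f)).
Proof. by rewrite !fmap_comp. Qed.

Definition functor_comp (C D E : category) (G : functor D E) (F : functor C D) :
    functor C E :=
  @Functor C E (fun a => G (F a)) (fun a b f => fmap G (fmap F f))
    (functor_comp_id G F) (@functor_comp_comp C D E G F).

(* Strict equality of functors (on objects and on morphisms), so this is an
   isomorphism, not merely an equivalence, of categories. *)
Definition is_cat_iso (C D : category) (F : functor C D) : Prop :=
  exists G : functor D C,
    functor_comp G F = functor_id C /\ functor_comp F G = functor_id D.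

(* The symmetric group S_X of an arbitrary, possibly infinite or empty, X. *)
Record permutation (X : Type) := Permutation {
  perm_fun :> X -> X;
  perm_bij : bijective perm_fun
}.

Record rack := Rack {
  carrier :> Type;
  rs : carrier -> permutation carrier;
  rack_ax : forall x y, rs x \o rs y =1 rs (rs x y) \o rs x
}.

Definition is_rack_hom (R1 R2 : rack) (f : R1 -> R2) : Prop :=
  forall x, f \o rs x =1 rs (f x) \o f.

Definition is_rack_aut (R : rack) (f : R -> R) : Prop :=
  is_rack_hom f /\ bijective f.

Definition is_GL (R : rack) (u : R -> R) : Prop :=
  is_rack_aut u /\ forall x, u \o rs x =1 rs x \o u.

Record is_biLegendrian (R : rack) (u d : R -> R) : Prop := IsBiLegendrian {
  biL1 : forall x, u (d (rs x x)) = x /\ x = d (u (rs x x));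
  biL2 : forall x, (u \o rs x =1 rs x \o u) /\ (d \o rs x =1 rs x \o d);
  biL3 : forall x, rs (u x) =1 rs x /\ rs x =1 rs (d x)
}.

Record GLrack := GLRack {
  gl_rack :> rack;
  gl_u : gl_rack -> gl_rack;
  gl_ax : is_GL gl_u
}.

Record BLrack := BLRack {
  bl_rack :> rack;
  bl_u : bl_rack -> bl_rack;
  bl_d : bl_rack -> bl_rack;
  bl_ax : is_biLegendrian bl_u bl_d
}.

Definition is_GL_hom (A B : GLrack) (f : A -> B) : Prop :=
  is_rack_hom f /\ f \o gl_u (g:=A) =1 gl_u (g:=B) \o f.

Definition is_BL_hom (A B : BLrack) (f : A -> B) : Prop :=
  [/\ is_rack_hom f, f \o bl_u (b:=A) =1 bl_u (b:=B) \o f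
    & f \o bl_d (b:=A) =1 bl_d (b:=B) \o f].

Record GLhom (A B : GLrack) := GLHom {
  gl_fun :> A -> B;
  gl_funP : is_GL_hom gl_fun
}.

Record BLhom (A B : BLrack) := BLHom {
  bl_fun :> A -> B;
  bl_funP : is_BL_hom bl_fun
}.

Lemma GLhom_eq (A B : GLrack) (f g : GLhom A B) : gl_fun f = gl_fun g -> f = g.
Proof.
by case: f g => [f fP] [g gP] /= e; subst g; rewrite (Prop_irrelevance fP gP).
Qed.

Lemma BLhom_eq (A B : BLrack) (f g : BLhom A B) : bl_fun f = bl_fun g -> f = g.
Proof.
by case: f g => [f fP] [g gP] /= e; subst g; rewrite (Prop_irrelevance fP gP).
Qed.

Lemma is_rack_hom_comp (A B C : rack) (g : B -> C) (f : A -> B) :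
  is_rack_hom g -> is_rack_hom f -> is_rack_hom (g \o f).
Proof.
by move=> gP fP x y /=; have /= -> := fP x y; have /= -> := gP (f x) (f y).
Qed.

Lemma GLidP (A : GLrack) : is_GL_hom (fun x : A => x).
Proof. by []. Qed.

Lemma BLidP (A : BLrack) : is_BL_hom (fun x : A => x).
Proof. by []. Qed.

Lemma GLcompP (A B C : GLrack) (g : GLhom B C) (f : GLhom A B) :
  is_GL_hom (g \o f).
Proof.
case: g f => g [gR gu] [f [fR fu]]; split=> /=; first exact: is_rack_hom_comp.
by move=> x /=; have /= -> := fu x; have /= -> := gu (f x).
Qed.

Lemma BLcompP (A B C : BLrack) (g : BLhom B C) (f : BLhom A B) :
  is_BL_hom (g \o f).
Proof.
case: g f => g [gR gu gd] [f [fR fu fd]]; split=> /=.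
- exact: is_rack_hom_comp.
- by move=> x /=; have /= -> := fu x; have /= -> := gu (f x).
- by move=> x /=; have /= -> := fd x; have /= -> := gd (f x).
Qed.

Definition GLid (A : GLrack) : GLhom A A := GLHom (@GLidP A).
Definition BLid (A : BLrack) : BLhom A A := BLHom (@BLidP A).

Definition GLcomp (A B C : GLrack) (g : GLhom B C) (f : GLhom A B) :
  GLhom A C := GLHom (GLcompP g f).
Definition BLcomp (A B C : BLrack) (g : BLhom B C) (f : BLhom A B) :
  BLhom A C := BLHom (BLcompP g f).

Lemma GLcomp_idl (A B : GLrack) (f : GLhom A B) : GLcomp (GLid B) f = f.
Proof. exact: GLhom_eq. Qed.

Lemma GLcomp_idr (A B : GLrack) (f : GLhom A B) : GLcomp f (GLid A) = f.
Proof. exact: GLhom_eq. Qed.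

Lemma GLcomp_assoc (A B C D : GLrack)
  (h : GLhom C D) (g : GLhom B C) (f : GLhom A B) :
  GLcomp h (GLcomp g f) = GLcomp (GLcomp h g) f.
Proof. exact: GLhom_eq. Qed.

Lemma BLcomp_idl (A B : BLrack) (f : BLhom A B) : BLcomp (BLid B) f = f.
Proof. exact: BLhom_eq. Qed.

Lemma BLcomp_idr (A B : BLrack) (f : BLhom A B) : BLcomp f (BLid A) = f.
Proof. exact: BLhom_eq. Qed.

Lemma BLcomp_assoc (A B C D : BLrack)
  (h : BLhom C D) (g : BLhom B C) (f : BLhom A B) :
  BLcomp h (BLcomp g f) = BLcomp (BLcomp h g) f.
Proof. exact: BLhom_eq. Qed.

Definition GLR : category :=
  @Category GLrack GLhom GLid GLcomp GLcomp_idl GLcomp_idr GLcomp_assoc.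

Definition BLR : category :=
  @Category BLrack BLhom BLid BLcomp BLcomp_idl BLcomp_idr BLcomp_assoc.

Lemma biLegendrian_GL (R : rack) (u d : R -> R) :
  is_biLegendrian u d -> is_GL u.
Proof.
case=> L1 L2 L3; have uS x := (L2 x).1.
split=> //; split.
  by move=> x y /=; rewrite (L3 x).1; exact: uS.
exists (fun x => d (rs x x)) => x; last by rewrite (L1 x).1.
by rewrite (L3 x).1; have /= <- := uS x x; rewrite -(L1 x).2.
Qed.

Definition forget_obj (A : BLR) : GLR := GLRack (biLegendrian_GL (bl_ax A)).

Lemma forget_homP (A B : BLR) (f : BLhom A B) :
  @is_GL_hom (forget_obj A) (forget_obj B) f.
Proof. by case: f => f []. Qed.

Definition forget_hom (A B : BLR) (f : hom A B) :
  hom (forget_obj A) (forget_obj B) := GLHom (forget_homP f).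

Lemma forget_id (A : BLR) : forget_hom (idm A) = idm (forget_obj A).
Proof. exact: GLhom_eq. Qed.

Lemma forget_comp (A B C : BLR) (g : hom B C) (f : hom A B) :
  forget_hom (comp g f) = comp (forget_hom g) (forget_hom f).
Proof. exact: GLhom_eq. Qed.

Definition forget : functor BLR GLR :=
  @Functor BLR GLR forget_obj forget_hom forget_id forget_comp.

(* Main.v *)
Require Import Defs.
From mathcomp Require Import all_boot.
From mathcomp Require Import boolp.

Set Implicit Arguments.
Unset Strict Implicit.
Unset Printing Implicit Defensive.

(** Let [theta x = s_x x].  In any rack [theta] is bijective with inverse
    [x |-> s_x^-1 x], because [s_x y = x] forces [s_y = s_x].  Axiom (L1) says
    that [d] is a two-sided inverse of [u], up to [theta], so [d] can only be
    [x |-> u^-1 (s_x^-1 x)]; this map satisfies (L2) and (L3) as soon as [u] is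
    a GL-structure.  Since [d] is expressed through [s] and [u], every GL-rack
    homomorphism commutes with it; for the identity map this is uniqueness. *)

Lemma rs_fixed_preimage (R : rack) (x y : R) : rs x y = x -> rs y =1 rs x.
Proof.
move=> e z; apply: (bij_inj (perm_bij (rs x))).
by have /= -> := rack_ax x y z; rewrite e.
Qed.

Lemma rs_diag_surj (R : rack) (x : R) : exists y : R, rs y y = x.
Proof.
have [t _ tK] := perm_bij (rs x); exists (t x).
by rewrite (rs_fixed_preimage (tK x)) tK.
Qed.

(** Both [rs (u x) \o u] and [rs x \o u] equal [u \o rs x], and the surjective [u] cancels on the
    right. *)
Lemma GL_rs (R : rack) (u : R -> R) (x : R) : is_GL u -> rs (u x) =1 rs x.
Proof.
move=> [[uR [v _ vK]] uS] y; rewrite -[y]vK.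
by have /= <- := uR x (v y); have /= -> := uS x (v y).
Qed.

Lemma biLegendrian_ex (R : rack) (u : R -> R) :
  is_GL u -> exists d : R -> R, is_biLegendrian u d.
Proof.
move=> uGL; have uL x := GL_rs x uGL; have [[_ [v uK vK]] uS] := uGL.
have /choice[t tK] : forall x : R, exists y, rs x y = x.
  by move=> x; have [t _ tK] := perm_bij (rs x); exists (t x).
have rsI (x : R) : injective (rs x) := bij_inj (perm_bij (rs x)).
have tL x : rs (t x) =1 rs x := rs_fixed_preimage (tK x).
(* By the rack axiom [rs x (t y)] solves the equation [rs (rs x y) z = rs x y] that determines
   [t (rs x y)]. *)
have tS x y : t (rs x y) = rs x (t y).
  apply: (rsI (rs x y)); rewrite tK.
  by have /= <- := rack_ax x y (t y); rewrite tK.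
have vS x y : v (rs x y) = rs x (v y).
  by rewrite -{1}[y]vK -[rs x (u _)](uS x) /= uK.
exists (fun x => v (t x)); split=> x.
- rewrite vK tS; split; first exact: tK.
  rewrite -[LHS]uK; congr (v _).
  by have /= -> := uS x x; rewrite tS -[RHS]uL tK.
- split=> y /=; first exact: (uS x y).
  by rewrite tS vS.
- split=> y; first exact: uL.
  by rewrite -[in RHS]uL vK tL.
Qed.

(** As [u] and [theta] are surjective, every element of [A] is some [u (rs y y)], which [d] sends to
    [y] by (L1); [f] carries this element to the one of the same form for [f y]. *)
Lemma biLegendrian_hom (A B : BLrack) (f : A -> B) :
  is_rack_hom f -> f \o bl_u (b:=A) =1 bl_u (b:=B) \o f ->
  f \o bl_d (b:=A) =1 bl_d (b:=B) \o f.
Proof.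
move=> fR fu x /=; have [[_ [v _ vK]] _] := biLegendrian_GL (bl_ax A).
have [y yE] := rs_diag_surj (v x).
rewrite -[x]vK -yE -(biL1 (bl_ax A) y).2.
have /= -> := fu (rs y y); have /= -> := fR y y.
by rewrite -(biL1 (bl_ax B) (f y)).2.
Qed.

Lemma biLegendrian_uniq (R : rack) (u d d' : R -> R) :
  is_biLegendrian u d -> is_biLegendrian u d' -> d = d'.
Proof.
move=> dP d'P; apply/funext.
exact: (@biLegendrian_hom (BLRack dP) (BLRack d'P) id).
Qed.

(* Compares morphisms whose endpoints are only propositionally equal. *)
Definition arrow (C : category) (a b : C) (f : hom a b) :
    {p : C * C & hom p.1 p.2} :=
  existT (fun p : C * C => hom p.1 p.2) (a, b) f.

(** The transport is along a proof of [(a, b) = (a, b)], which proof irrelevance turns into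
    [erefl]. *)
Lemma arrow_inj (C : category) (a b : C) (f g : hom a b) :
  arrow f = arrow g -> f = g.
Proof.
by move=> e; have := projT2_eq e; rewrite (Prop_irrelevance (projT1_eq e) erefl).
Qed.

Lemma functor_eq (C D : category) (F G : functor C D) :
  (forall a b (f : hom a b), arrow (fmap F f) = arrow (fmap G f)) -> F = G.
Proof.
case: F G => [Fo Fm F1 FM] [Go Gm G1 GM] /= FG.
(* The arrow of an identity records its endpoints, so agreement on arrows forces agreement on
   objects. *)
have e : Fo = Go by apply/funext => a; case: (projT1_eq (FG _ _ (idm a))).
subst Go.
have e : Fm = Gm.
  apply: functional_extensionality_dep => a.
  apply: functional_extensionality_dep => b.
  by apply/funext => f; apply: arrow_inj.
subst Gm.
by rewrite (Prop_irrelevance F1 G1) (Prop_irrelevance FM GM).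
Qed.

Lemma GLarrow_eq (R S : rack) (u : R -> R) (v : S -> S)
    (uP uP' : is_GL u) (vP vP' : is_GL v)
    (f : @hom GLR (GLRack uP) (GLRack vP))
    (g : @hom GLR (GLRack uP') (GLRack vP')) :
  gl_fun f = gl_fun g :> (R -> S) -> arrow f = arrow g.
Proof.
move: f g; rewrite (Prop_irrelevance uP' uP) (Prop_irrelevance vP' vP) => f g e.
by rewrite (@GLhom_eq (GLRack uP) (GLRack vP) f g e).
Qed.

Lemma BLarrow_eq (R S : rack) (u d d' : R -> R) (v e e' : S -> S)
    (dP : is_biLegendrian u d) (d'P : is_biLegendrian u d')
    (eP : is_biLegendrian v e) (e'P : is_biLegendrian v e')
    (f : @hom BLR (BLRack dP) (BLRack eP))
    (g : @hom BLR (BLRack d'P) (BLRack e'P)) :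
  bl_fun f = bl_fun g :> (R -> S) -> arrow f = arrow g.
Proof.
move: (biLegendrian_uniq dP d'P) (biLegendrian_uniq eP e'P) => dE eE.
subst d' e'; move: f g.
rewrite (Prop_irrelevance d'P dP) (Prop_irrelevance e'P eP) => f g fg.
by rewrite (@BLhom_eq (BLRack dP) (BLRack eP) f g fg).
Qed.

(** The choice made by [cid] is harmless, since [d] is unique. *)
Definition complete_obj (A : GLR) : BLR :=
  BLRack (projT2 (cid (biLegendrian_ex (gl_ax A)))).

Lemma complete_homP (A B : GLR) (f : GLhom A B) :
  @is_BL_hom (complete_obj A) (complete_obj B) f.
Proof.
by case: f => f [fR fu]; split=> //; apply: biLegendrian_hom.
Qed.

Definition complete_hom (A B : GLR) (f : hom A B) :
  hom (complete_obj A) (complete_obj B) := BLHom (complete_homP f).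

Lemma complete_id (A : GLR) : complete_hom (idm A) = idm (complete_obj A).
Proof. exact: BLhom_eq. Qed.

Lemma complete_comp (A B C : GLR) (g : hom B C) (f : hom A B) :
  complete_hom (Defs.comp g f) =
    Defs.comp (complete_hom g) (complete_hom f).
Proof. exact: BLhom_eq. Qed.

Definition complete : functor GLR BLR :=
  @Functor GLR BLR complete_obj complete_hom complete_id complete_comp.

Theorem proposition3p12 :
  is_cat_iso forget /\
  (forall R : rack,
    (forall u d : R -> R, is_biLegendrian u d -> is_GL u) /\
    (forall u : R -> R, is_GL u -> exists! d : R -> R, is_biLegendrian u d)).
Proof.
split.
  exists complete; split; apply: functor_eq.
    (* The round trip replaces [d] by the chosen one, equal to it by uniqueness; on GL-racks only
       the proof of [is_GL] changes. *)
    by case=> [R u d dP] [S v e eP] f; apply: BLarrow_eq.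
  by case=> [R u uP] [S v vP] f; apply: GLarrow_eq.
move=> R; split=> u; first exact: biLegendrian_GL.
move=> /biLegendrian_ex[d dP]; exists d; split=> // d'.
exact: biLegendrian_uniq.
Qed.
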